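(* Let $d\ge 1$, let $X$ be a separable $F$-space and let $(T_a)_{a\in\mathbb R^d}$ be a strongly continuous operator group on $X$ with the uniform mixing property. Then $\bigcap_{a\in\mathbb R^d\setminus\{0\}}HC(T_a)$ is a residual subset of $X$.
   Context: A separable $F$-space is a separable topological vector space carrying a complete translation-invariant metric. An operator group $(T_a)_{a\in\mathbb R^d}$ on $X$ is a family of continuous linear operators on $X$ with $T_0=I$ and $T_{a+b}=T_aT_b$ for all $a,b\in\mathbb R^d$; it is strongly continuous if $a\mapsto T_af$ is continuous for each $f\in X$. For a continuous linear operator $T$ on $X$, $HC(T)$ is the set of $x\in X$ such that $\{T^nx:\ n\ge 0\}$ is dense in $X$. $\|\cdot\|$ on $\mathbb R^d$ is the Euclidean norm. Uniform mixing property: for any nonempty open subsets $U,V$ of $X$ there exists $C>0$ such that, for any $p\ge 1$ and any $a_1,\dots,a_p\in\mathbb R^d$ with $\|a_i\|\ge C$ for all $i$ and $\|a_i-a_j\|\ge C$ for all $i\ne j$, there exists $f\in U$ such that $T_{a_j}f\in V$ for every $j=1,\dots,p$. Residual means containing a dense $G_\delta$ subset. *)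

(* Defs.v *)
From mathcomp Require Import all_boot all_order all_algebra.
From mathcomp Require Import all_classical all_reals topology normedtype.
From mathcomp Require Import borel_hierarchy.
From mathcomp.real_closed Require Import complex.

Set Implicit Arguments.
Unset Strict Implicit.
Unset Printing Implicit Defensive.

Import Order.TTheory GRing.Theory Num.Theory.
Import numFieldNormedType.Exports.

Local Open Scope classical_set_scope.
Local Open Scope ring_scope.

(* The scalar field: the complex numbers R[i] if [b], the real numbers R
   otherwise. *)
Definition scalars (R : realType) (b : bool) : numFieldType :=
  if b then (R[i] : numFieldType) else (R : numFieldType).

(* The structures [metricType] and [completeType] cannot be joined with
   [topologicalLmodType], so that the metric is a function on a topological
   vector space, required to induce its topology. *)
Section FSpaces.
Variables (R : realType) (b : bool) (X : topologicalLmodType (scalars R b)).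

Record complete_invariant_metric (rho : X -> X -> R) : Prop := {
  rhoxx : forall x, rho x x = 0;
  rho_positivity : forall x y, rho x y = 0 -> x = y;
  rho_sym : forall x y, rho x y = rho y x;
  rho_triangle : forall y x z, rho x z <= rho x y + rho y z;
  rho_nbhs : forall (x : X) (A : set X),
    nbhs x A <-> exists2 e : R, 0 < e & [set y | rho x y < e] `<=` A;
  rho_invariant : forall z x y, rho (x + z) (y + z) = rho x y;
  rho_complete : forall u : nat -> X,
    (forall e : R, 0 < e -> exists N, forall m n,
      (N <= m)%N -> (N <= n)%N -> rho (u m) (u n) < e) ->
    exists l : X, u @ \oo --> l
}.

Definition F_space : Prop := exists rho, complete_invariant_metric rho.

End FSpaces.

Definition separable (X : topologicalType) :=
  exists2 D : set X, countable D & dense D.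

Definition residual (X : topologicalType) (A : set X) :=
  exists G : set X, [/\ Gdelta G, dense G & G `<=` A].

(* The norm [`|a|] of the library on ['rV[R]_d] is the sup norm. *)
Definition enorm (R : realType) (d : nat) (a : 'rV[R]_d) : R :=
  Num.sqrt (\sum_(i < d) a 0 i ^+ 2).

Definition HC (X : topologicalType) (T : X -> X) : set X :=
  [set x | dense (range (fun n => iter n T x))].

Section OperatorGroups.
Variables (R : realType) (b : bool) (X : topologicalLmodType (scalars R b)).
Variable d : nat.
Implicit Type T : 'rV[R]_d -> {linear X -> X}.

Definition operator_group T :=
  [/\ forall a, continuous (T a),
      forall f, T 0 f = f
    & forall a a' f, T (a + a') f = T a (T a' f)].

Definition strongly_continuous T := forall f, continuous (fun a => T a f).

Definition uniform_mixing T :=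
  forall U V : set X, open U -> U !=set0 -> open V -> V !=set0 ->
  exists2 C : R, 0 < C &
    forall (p : nat) (a : 'I_p -> 'rV[R]_d), (1 <= p)%N ->
      (forall i, C <= enorm (a i)) ->
      (forall i j, i != j -> C <= enorm (a i - a j)) ->
    exists2 f, U f & forall j, V (T (a j) f).

End OperatorGroups.

(* Main.v *)
(* Fix nonempty open sets [U] and [V], and let [C] be the constant of the uniform
   mixing property for [U] and a ball around a point of [V]. The nonzero points
   of the lattice [C Z^d] are [C]-separated and of norm at least [C], and by
   Dirichlet's simultaneous approximation theorem every [a <> 0] has a positive
   multiple close to one of them, with finitely many lattice points sufficing
   for all [a] in a compact set avoiding [0]. Since [(a, f) |-> T_a f] is
   continuous at [(0, v)], by Baire, some [f] in [U] has an iterate under [T_a]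
   in [V] for all these [a] at once, and so do the points near [f]. The theorem
   follows from Baire's theorem over a countable base and a countable cover of
   the parameters by compact sets. *)
Require Import Defs.
From mathcomp Require Import all_boot all_order all_algebra.
From mathcomp Require Import all_classical all_reals topology normedtype.
From mathcomp Require Import borel_hierarchy interval_inference.
From mathcomp Require Import ring lra zify.
Import Order.TTheory GRing.Theory Num.Theory.
Import numFieldNormedType.Exports.
Local Open Scope classical_set_scope.
Local Open Scope ring_scope.

Set Implicit Arguments.
Unset Strict Implicit.
Unset Printing Implicit Defensive.

(** * Diophantine approximation by lattice points *)

Lemma exists_natSinv_lt (R : realType) (e : R) :
  0 < e -> exists n : nat, n.+1%:R^-1 < e.
Proof.
move=> e0; have [n _ nP] := near_infty_natSinv_lt (PosNum e0).
by exists n; exact: nP (leqnn n).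
Qed.

Lemma truncn_eq_dist (R : realType) (x y : R) :
  0 <= x -> 0 <= y -> Num.truncn x = Num.truncn y -> `|x - y| < 1.
Proof.
move=> /truncn_itv/andP[xl xr] /truncn_itv/andP[yl yr] xy.
rewrite xy in xl xr; rewrite -natr1 in xr yr.
by rewrite ltr_norml; apply/andP; split; lra.
Qed.

(* Pigeonhole on the fractional parts of [k * a / C], [k <= N], sorted into
   boxes of side [1/(q+1)]. *)
Lemma simultaneous_Dirichlet (R : realType) (d : nat) (C e : R) :
  0 < C -> 0 < e -> exists N : nat, forall a : 'rV[R]_d,
  exists2 n : nat, (0 < n <= N)%N &
  exists z : 'I_d -> int, forall i, `|(a *+ n) 0 i - C * (z i)%:~R| < e.
Proof.
move=> C_gt0 e_gt0.
have [|q qe] := @exists_natSinv_lt _ (e / C); first by rewrite divr_gt0.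
(* With [N] boxes and the [N + 1] indices [0..N], two indices share a box and their difference lies
   between 1 and [N]. *)
exists #|{ffun 'I_d -> 'I_q.+1}| => a.
set N := #|_|.
pose x (k : nat) i : R := k%:R * a 0 i / C.
pose u k i := x k i - (Num.floor (x k i))%:~R.
have u_itv k i : 0 <= u k i < 1.
  have /andP[] := floor_itv (x k i).
  by rewrite intrD1 /u => ? ?; apply/andP; split; lra.
pose box (k : 'I_N.+1) : {ffun 'I_d -> 'I_q.+1} :=
  [ffun i => inord (Num.truncn (q.+1%:R * u k i))].
have : ~~ injectiveb box.
  by apply/injectiveP => /leq_card; rewrite card_ord ltnn.
move=> /injectivePn[k [k' kk' boxkk']].
wlog lt_kk' : k k' kk' boxkk' / (k < k')%N.
  move=> wl; have := kk'; rewrite -val_eqE/= neq_ltn => /orP[|] lt.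
    exact: wl lt.
  by apply: (wl k' k) lt; rewrite 1?eq_sym.
exists (k' - k)%N.
  by rewrite subn_gt0 lt_kk' /= (leq_trans (leq_subr _ _))// -ltnS.
(* Fractional parts in a common box differ by less than [1/(q+1) < e / C], so differences of floors
   are the right integers. *)
exists (fun i => Num.floor (x k' i) - Num.floor (x k i)) => i.
have box_trunc (j : 'I_N.+1) : box j i = Num.truncn (q.+1%:R * u j i) :> nat.
  rewrite ffunE inordK// truncn_lt_nat; last by rewrite mulr_ge0//; case/andP: (u_itv j i).
  by rewrite -ltr_pdivlMl// mulVf ?pnatr_eq0//; case/andP: (u_itv j i).
have : `|q.+1%:R * u k' i - q.+1%:R * u k i| < 1.
  apply: truncn_eq_dist; rewrite -?box_trunc ?boxkk'// mulr_ge0//.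
  + by case/andP: (u_itv k' i).
  + by case/andP: (u_itv k i).
rewrite -mulrBr normrM ger0_norm// -ltr_pdivlMl// mulr1 => /lt_trans/(_ qe).
rewrite ltr_pdivlMr// -[X in _ * X < _](ger0_norm (ltW C_gt0)) -normrM.
congr (`|_| < _); rewrite /u /x mulmxnE mulrnBr; last exact: ltnW.
rewrite intrB -[_ *+ k']mulr_natl -[_ *+ k]mulr_natl.
by field; rewrite gt_eqF.
Qed.

Lemma ler_coord_enorm (R : realType) (d : nat) (a : 'rV[R]_d) i :
  `|a 0 i| <= enorm a.
Proof.
rewrite -sqrtr_sqr ler_wsqrtr// (bigD1 i)//= lerDl sumr_ge0// => j _.
exact: sqr_ge0.
Qed.

Lemma normr_intr_ge1 (R : realType) (z : int) : z != 0 -> 1 <= `|z%:~R : R|.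
Proof.
move=> z0.
by rewrite -intr_norm -[1]/(1%:~R) ler_int -gtz0_ge1 normr_gt0.
Qed.

(* The points are the nonzero points of the lattice [C Z^d] in a large box; a
   first dilation of [a] keeps its multiples away from the origin. *)
Lemma multiples_meet_separated_set (R : realType) (d : nat) (C e c D : R) :
  0 < C -> 0 < e -> 0 < c ->
  exists (p : nat) (x : 'I_p -> 'rV[R]_d),
  [/\ forall j, C <= enorm (x j),
      forall i j, i != j -> C <= enorm (x i - x j) &
      forall a : 'rV[R]_d, (exists i, c <= `|a 0 i|) ->
        (forall i, `|a 0 i| <= D) ->
        exists n j, ball 0 e (a *+ n - x j)].
Proof.
move=> C_gt0 e_gt0 c_gt0.
have [N NP] := @simultaneous_Dirichlet R d C e C_gt0 e_gt0.
(* Every positive multiple of [a *+ m] has a coordinate larger than [e] in size, so a lattice point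
   within [e] of it is nonzero. *)
pose m := Num.bound (e / c).
have m_c : e < m%:R * c.
  by rewrite -ltr_pdivrMr// archi_boundP// divr_ge0// ltW.
(* Bounds the integer coordinates of the approximating lattice points; the indices [0..2M] below
   encode [-M..M]. *)
pose M := Num.bound (((m * N)%:R * `|D| + e) / C).
pose W := {ffun 'I_d -> 'I_(M + M).+1}.
pose z (w : W) i : int := (w i : nat)%:Z - M%:Z.
pose pt (w : W) : 'rV[R]_d := \row_i (C * (z w i)%:~R).
pose A := [pred w : W | [exists i, z w i != 0]].
exists #|A|, (fun j => pt (enum_val j)); split.
- move=> j; have /existsP[i zi] := enum_valP j.
  apply: le_trans (ler_coord_enorm _ i); rewrite mxE normrM (gtr0_norm C_gt0).
  by rewrite ler_pMr// normr_intr_ge1.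
- move=> j j' jj'.
  have /eqP/ffunP : enum_val j != enum_val j' :> W.
    by apply: contra jj' => /eqP/enum_val_inj ->.
  move=> /existsNP[i /eqP neq_i].
  apply: le_trans (ler_coord_enorm _ i).
  rewrite !mxE -mulrBr -intrB normrM (gtr0_norm C_gt0) ler_pMr// normr_intr_ge1//.
  rewrite /z subr_eq0; apply: contra neq_i => /eqP/addIr[?].
  exact/eqP/val_inj.
- move=> a [i0 ai0] aD.
  have [n /andP[n_gt0 nN] [y yP]] := NP (a *+ m).
  have {}yP i : `|(m * n)%:R * a 0 i - C * (y i)%:~R| < e.
    by have := yP i; rewrite -mulrnA mulmxnE mulr_natl.
  have y_le i : `|y i| <= M%:Z.
    rewrite -(ler_int R) intr_norm -[(M%:Z)%:~R]/(M%:R : R).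
    apply: (le_trans _ (ltW (archi_boundP _))); last first.
      by rewrite divr_ge0 ?(ltW C_gt0)// addr_ge0 ?(ltW e_gt0)// mulr_ge0.
    rewrite ler_pdivlMr// mulrC -{1}(gtr0_norm C_gt0) -normrM.
    have : `|(m * n)%:R * a 0 i| <= (m * N)%:R * `|D|.
      rewrite normrM ger0_norm// ler_pM// ?ler_nat ?leq_mul//.
      exact: le_trans (aD i) (ler_norm _).
    have := yP i; rewrite distrC => /ltW yi ai.
    by rewrite -[C * _](subrK ((m * n)%:R * a 0 i)) (le_trans (ler_normD _ _))// addrC lerD.
  have y_gt i : (0 <= y i + M%:Z) && (y i + M%:Z < (M + M).+1%:Z).
    by have := y_le i; rewrite ler_norml => /andP[? ?]; apply/andP; split; lia.
  pose w : W := [ffun i => inord (absz (y i + M%:Z))].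
  have wy i : z w i = y i.
    have /andP[y0 yM] := y_gt i.
    rewrite /z ffunE inordK ?gez0_abs ?addrK//.
    by rewrite -ltz_nat gez0_abs.
  have wA : w \in A.
    apply/existsP; exists i0; rewrite wy; apply/eqP => y0.
    have := yP i0; rewrite y0 mulr0 subr0 normrM ger0_norm// => /(le_lt_trans _).
    move=> /(_ (m%:R * c)); rewrite natrM -mulrA ler_wpM2l//; last first.
      by rewrite -[c]mul1r ler_pM// ?(ltW c_gt0)// ler1n.
    by move=> /(_ isT); lra.
  exists (m * n)%N, (enum_rank_in wA w); rewrite enum_rankK_in//.
  split=> // i j; rewrite ord1.
  rewrite -ball_normE /ball_ /= !mxE sub0r normrN mulmxnE wy -mulr_natl.
  exact: yP.
Qed.

(** * Baire's theorem for a complete invariant metric *)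

Section InvariantMetric.
Variables (R : realType) (b : bool) (X : topologicalLmodType (scalars R b)).
Variables (rho : X -> X -> R) (rhoP : complete_invariant_metric rho).

Lemma rho_shift x y z : rho (z + x) (z + y) = rho x y.
Proof. by rewrite ![z + _]addrC (rho_invariant rhoP). Qed.

Lemma nbhs_rho x e : 0 < e -> nbhs x [set y | rho x y < e].
Proof. by move=> e0; apply/(rho_nbhs rhoP); exists e. Qed.

Lemma open_rho x e : open [set y | rho x y < e].
Proof.
rewrite openE => y /= xy; apply/(rho_nbhs rhoP).
exists (e - rho x y) => [|z /= yz]; first by rewrite subr_gt0.
by have := rho_triangle rhoP y x z; lra.
Qed.

Lemma open_rhoP (O : set X) x :
  open O -> O x -> exists2 e : R, 0 < e & [set y | rho x y < e] `<=` O.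
Proof. by rewrite openE => /(_ x) oO /oO /(rho_nbhs rhoP). Qed.

Lemma rho_cvg_le (u : nat -> X) l x e N : u @ \oo --> l ->
  (forall n, (N <= n)%N -> rho x (u n) <= e) -> rho x l <= e.
Proof.
move=> ul xu; apply/ler_addgt0Pr => e' e'0.
have [M _ MP] := ul _ (nbhs_rho l e'0).
have := MP (maxn M N) (leq_maxl _ _); rewrite /= => lu.
have := xu _ (leq_maxr M N); have := rho_triangle rhoP (u (maxn M N)) x l.
by rewrite (rho_sym rhoP (u _) l); lra.
Qed.

(** Nested closed balls, the one of stage [n + 1] inside [G n] and of radius below [1/(n+1)]: the
    centres form a Cauchy sequence, whose limit lies in all the balls. *)
Lemma rho_Baire (G : nat -> set X) :
  (forall i, open (G i) /\ dense (G i)) -> dense (\bigcap_i G i).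
Proof.
move=> GP O [x0 Ox0] oO; have [e0 e00 e0O] := open_rhoP oO Ox0.
(* The positivity of the radius is a premise inside the existential, so that [choice] yields a total
   step function. *)
have next (np : nat * (X * R)) : exists q : X * R, 0 < np.2.2 ->
    [/\ 0 < q.2, q.2 < np.1.+1%:R^-1 &
      forall y, rho q.1 y <= q.2 -> rho np.2.1 y < np.2.2 /\ G np.1 y].
  case: np => n [x e] /=; have [e_gt0|_] := ltP 0 e; last by exists (x, e).
  have [oG dG] := GP n.
  have [|y [xy Gy]] := dG [set y | rho x y < e] _ (open_rho x e).
    by exists x => /=; rewrite (rhoxx rhoP).
  have [e1 e10 e1P] := open_rhoP (openI (open_rho x e) oG) (conj xy Gy).
  (* Halving [e1] puts the closed ball inside the open one. *)
  exists (y, Num.min (e1 / 2) (n.+1%:R^-1 / 2)) => _ /=; split.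
  - by rewrite lt_min !divr_gt0.
  - rewrite gt_min; apply/orP; right.
    by rewrite ltr_pdivrMr// ltr_pMr ?invr_gt0 ?ltr0n ?ltr1n.
  - move=> z; rewrite le_min => /andP[yz _].
    by apply: e1P => /=; lra.
have [step stepP] := choice next.
pose s := fix s n := if n is m.+1 then step (m, s m) else (x0, e0).
have s_gt0 n : 0 < (s n).2.
  by elim: n => [//|n IH]; have [] := stepP (n, s n) IH.
have s_small n : (s n.+1).2 < n.+1%:R^-1 by have [] := stepP (n, s n) (s_gt0 n).
have s_nest n y : rho (s n.+1).1 y <= (s n.+1).2 ->
    rho (s n).1 y < (s n).2 /\ G n y.
  by have [_ _] := stepP (n, s n) (s_gt0 n); exact.
have s0 : s 0%N = (x0, e0) by [].
clearbody s.
have s_ball m n : (m <= n)%N -> rho (s m).1 (s n).1 <= (s m).2.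
  move=> mn; suff: forall y, rho (s n).1 y <= (s n).2 -> rho (s m).1 y <= (s m).2.
    by apply; rewrite (rhoxx rhoP) ltW.
  elim: n mn => [|n IH]; first by rewrite leqn0 => /eqP ->.
  rewrite leq_eqVlt => /orP[/eqP -> //|mn y /s_nest[/ltW yn _]].
  exact: IH.
have [|l sl] := rho_complete rhoP (u := fun n => (s n).1).
  move=> e e_gt0; have [|N Ne] := @exists_natSinv_lt _ (e / 2).
    by rewrite divr_gt0.
  exists N.+1 => m n Nm Nn.
  have := s_ball _ _ Nm; have := s_ball _ _ Nn; have := lt_trans (s_small N) Ne.
  have := rho_triangle rhoP (s N.+1).1 (s m).1 (s n).1.
  by rewrite (rho_sym rhoP (s m).1 (s N.+1).1); lra.
have s_lim n : rho (s n).1 l <= (s n).2.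
  by apply: (rho_cvg_le sl) => m; exact: s_ball.
exists l; split; last by move=> n _; have [] := s_nest n l (s_lim n.+1).
by apply: e0O; have [] := s_nest 0%N l (s_lim 1%N); rewrite s0.
Qed.

(** * Joint continuity of the group at the origin, and mixing *)

Section Group.
Variables (d : nat) (T : 'rV[R]_d -> {linear X -> X}).
Hypotheses (groupT : operator_group T) (contT : strongly_continuous T).

Lemma iter_operator_group a n f : iter n (T a) f = T (a *+ n) f.
Proof.
have [_ T0 TD] := groupT.
by elim: n => [|n IH]; rewrite ?mulr0n ?T0// mulrS TD /= IH.
Qed.

(* The sets of [f] moved by at most [e] by all [T_a], [|a| < 1/(n+1)], are
   closed and exhaust [X] by strong continuity; by Baire one of them has
   interior, and linearity transports this to the origin. *)
Lemma operator_group_equicontinuous0 (e : R) : 0 < e ->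
  exists2 r : R, 0 < r &
    forall a h, ball 0 r a -> rho 0 h < r -> rho 0 (T a h) < e.
Proof.
move=> e_gt0; have [Tc T0 _] := groupT.
pose e3 := e / 4; have e3_gt0 : 0 < e3 by rewrite divr_gt0.
pose F n := [set f | forall a, ball 0 n.+1%:R^-1 a -> rho (T a f) f <= e3].
have openCF n : open (~` F n).
  rewrite openE => f /existsNP[a /not_implyP[a_ball /negP]]; rewrite -ltNge => fa.
  (* Half the excess: moving [f] and [T a f] by less than [r] each keeps their distance above
     [e3]. *)
  pose r := (rho (T a f) f - e3) / 2.
  have r_gt0 : 0 < r by rewrite divr_gt0// subr_gt0.
  have : nbhs f [set g | rho (T a f) (T a g) < r] by exact: Tc (nbhs_rho _ r_gt0).
  move=> /filterI/(_ (nbhs_rho f r_gt0)); apply: filterS => g [/= Tg fg] /(_ a a_ball).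
  have := rho_triangle rhoP (T a g) (T a f) f.
  have := rho_triangle rhoP g (T a g) f.
  by rewrite (rho_sym rhoP g f) /r in Tg fg *; lra.
have [n ndense] : exists n, ~ dense (~` F n).
  apply/existsNP => allF.
  have /(_ setT) [] := rho_Baire (fun n => conj (openCF n) (allF n)).
  - by exists 0.
  - exact: openT.
  move=> f [_ fP].
  have : nbhs (0 : 'rV[R]_d) [set a | rho (T 0 f) (T a f) < e3].
    by exact: contT (nbhs_rho _ e3_gt0).
  move=> /nbhs_ballP[r /= r_gt0 rP]; have [n nr] := exists_natSinv_lt r_gt0.
  apply: (fP n I) => a a_ball.
  have := rP a (le_ball (ltW nr) a_ball).
  by rewrite /= T0 (rho_sym rhoP f) => /ltW.
have [O [[g [oO Og]] OF]] := denseNE ndense.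
have {}OF f : O f -> F n f.
  by move=> Of; apply: contrapT => nF; have : (O `&` ~` F n) f by []; rewrite OF.
have [r r_gt0 rP] := open_rhoP oO Og.
exists (Num.min e3 (Num.min r n.+1%:R^-1)).
  by rewrite !lt_min e3_gt0 r_gt0 invr_gt0 ltr0n.
move=> a h a_ball; rewrite !lt_min => /and3P[h_e h_r _].
have {}a_ball : ball 0 n.+1%:R^-1 a.
  by apply: le_ball a_ball; rewrite !ge_min lexx !orbT.
have Fg := OF _ Og a a_ball.
have Fgh : rho (T a (g + h)) (g + h) <= e3.
  by apply: OF a_ball; apply: rP => /=; rewrite -[X in rho X _]addr0 rho_shift.
rewrite linearD in Fgh.
(* Go from [0] to [h], then from [h] to [T a h]; translated by [T a g], the second leg passes
   through [g + h]. This makes three distances of at most [e3]. *)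
have := rho_triangle rhoP h 0 (T a h).
rewrite -(rho_shift h (T a h) (T a g)) (rho_sym rhoP (_ + h)).
have := rho_triangle rhoP (g + h) (T a g + T a h) (T a g + h).
have : rho (g + h) (T a g + h) <= e3 by rewrite (rho_invariant rhoP) (rho_sym rhoP).
by rewrite /e3 in h_e Fgh *; lra.
Qed.

(** Split [T a f - v] as [T a (f - v) + (T a v - v)]: equicontinuity at the origin controls the
    first term, strong continuity the second. *)
Lemma operator_group_continuous0 (V : set X) v : open V -> V v ->
  exists2 r : R, 0 < r & forall a f, ball 0 r a -> rho v f < r -> V (T a f).
Proof.
move=> oV Vv; have [e e_gt0 eV] := open_rhoP oV Vv.
have [_ T0 _] := groupT.
have e2_gt0 : 0 < e / 2 by rewrite divr_gt0.
have [r1 r1_gt0 r1P] := operator_group_equicontinuous0 e2_gt0.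
have : nbhs (0 : 'rV[R]_d) [set a | rho (T 0 v) (T a v) < e / 2].
  by exact: contT (nbhs_rho _ e2_gt0).
move=> /nbhs_ballP[r2 /= r2_gt0 r2P].
exists (Num.min r1 r2); first by rewrite lt_min r1_gt0.
move=> a f a_ball; rewrite lt_min => /andP[vf _].
apply: eV => /=.
have := r2P a; rewrite /= T0 => /(_ _) va.
have {}va : rho v (T a v) < e / 2.
  by apply: va; apply: le_ball a_ball; rewrite ge_min lexx orbT.
have := r1P a (f - v); rewrite -(rho_shift 0 (f - v) v) addr0 addrC subrK.
rewrite -(rho_shift 0 (T a (f - v)) (T a v)) addr0 -linearD.
rewrite [v + _]addrC subrK => /(_ _ vf) Tvf.
have := rho_triangle rhoP (T a v) v (T a f).
have : rho (T a v) (T a f) < e / 2.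
  by apply: Tvf; apply: le_ball a_ball; rewrite ge_min lexx.
lra.
Qed.

(** The condition on all [a] follows from finitely many open conditions on [f], one per lattice
    point, hence the interior. *)
Lemma multiples_hit_dense (V : set X) (c D : R) :
  uniform_mixing T -> open V -> V !=set0 -> 0 < c ->
  dense (interior [set f | forall a : 'rV[R]_d, (exists i, c <= `|a 0 i|) ->
    (forall i, `|a 0 i| <= D) -> exists n, V (iter n (T a) f)]).
Proof.
move=> mixT oV [v Vv] c_gt0 U U0 oU; have [Tc _ TD] := groupT.
have [r r_gt0 rV] := operator_group_continuous0 oV Vv.
have [|C C_gt0 CP] := mixT _ _ oU U0 (open_rho v r).
  by exists v => /=; rewrite (rhoxx rhoP).
have [p [x [x_ge x_sep x_hit]]] :=
  @multiples_meet_separated_set R d C r c D C_gt0 r_gt0 c_gt0.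
have [f Uf fV] : exists2 f, U f & forall j, rho v (T (x j) f) < r.
  (* Mixing requires [p >= 1]; without points any element of [U] will do. *)
  case: p => [|p] in x x_ge x_sep x_hit *; last exact: CP.
  by case: U0 => f Uf; exists f => // -[].
exists f; split=> //.
have /filter_forall : forall j, nbhs f [set g | rho v (T (x j) g) < r].
  move=> j; apply: (Tc (x j) f [set g | rho v g < r]).
  exact: open_nbhs_nbhs (conj (open_rho v r) (fV j)).
apply: filterS => g gV a ac aD.
have [n [j nj]] := x_hit a ac aD.
by exists n; rewrite iter_operator_group -[a *+ n](subrK (x j)) TD; exact: rV nj (gV j).
Qed.

End Group.
End InvariantMetric.

(** * The countable intersection *)

Theorem theorem1p1 (R : realType) (b : bool)
    (X : topologicalLmodType (scalars R b)) (d : nat)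
    (T : 'rV[R]_d -> {linear X -> X}) :
  (1 <= d)%N -> F_space X -> separable X ->
  operator_group T -> strongly_continuous T -> uniform_mixing T ->
  residual (\bigcap_(a in [set a : 'rV[R]_d | a != 0]) HC (T a)).
Proof.
move=> _ [rho rhoP] [S countS denseS] groupT contT mixT.
have [|[s]] := pfcard_geP countS.
  move=> S0; have [|x [_]] := denseS setT _ openT; first by exists 0.
  by rewrite S0.
pose V (jm : nat * nat) := [set y | rho (s jm.1) y < jm.2.+1%:R^-1].
(* The index codes a ball and a compact shell of parameters; codes of nothing give [setT], which
   leaves the intersection unchanged. *)
pose G (i : nat) := if unpickle i is Some (jm, k) then
  interior [set f | forall a : 'rV[R]_d, (exists i, k.+1%:R^-1 <= `|a 0 i|) ->
    (forall i, `|a 0 i| <= k.+1%:R) -> exists n, V jm (iter n (T a) f)]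
  else setT.
have GP i : open (G i) /\ dense (G i).
  rewrite /G; case: unpickle => [[jm k]|]; last first.
    by split; [exact: openT|move=> O O0 _; rewrite setIT].
  split; first exact: open_interior.
  apply: (multiples_hit_dense rhoP) => //.
  - exact: open_rho.
  - by exists (s jm.1); rewrite /V/= (rhoxx rhoP).
exists (\bigcap_i G i); split; first by exists G => // i; have [] := GP i.
  exact: (rho_Baire rhoP).
move=> f fG a /= /rV0Pn[i0 ai0] O [x Ox] oO.
have [e e_gt0 eO] := open_rhoP rhoP oO Ox.
(* A ball of radius [1/(m+1) < e / 2] whose centre is that close to [x] stays within [e] of [x]. *)
have [|m me] := @exists_natSinv_lt R (e / 2); first by rewrite divr_gt0.
have [|y [xy Sy]] := denseS [set y | rho x y < m.+1%:R^-1] _ (open_rho rhoP _ _).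
  by exists x => /=; rewrite (rhoxx rhoP).
have [j _ sj] : (s @` setT) y by exact: (@surj _ _ _ _ s).
have [|k1 k1P] := @exists_natSinv_lt R `|a 0 i0|; first by rewrite normr_gt0.
(* Puts [a] in shell [k]: [k1] serves the lower bound on one coordinate, the sum the upper bound on
   all. *)
pose k := maxn k1 (Num.bound (\sum_i `|a 0 i|)).
have := fG (pickle ((j, m), k)) I; rewrite /G pickleK => /interior_subset/(_ a)[].
- exists i0; apply: le_trans (ltW k1P).
  by rewrite lef_pV2 ?posrE ?ltr0n// ler_nat ltnS leq_maxl.
- move=> i; apply: (@le_trans _ _ (\sum_i `|a 0 i|)).
    by rewrite (bigD1 i)//= lerDl sumr_ge0.
  apply: (le_trans (ltW (archi_boundP _))); first by rewrite sumr_ge0.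
  by rewrite ler_nat (leq_trans (leq_maxr k1 _)).
move=> n; rewrite /V/= sj => yTf.
exists (iter n (T a) f); split; last by exists n.
apply: eO; apply: le_lt_trans (rho_triangle rhoP y _ _) _.
by have := lt_trans xy me; have := lt_trans yTf me; lra.
Qed.
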